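(* Let $f\in\mathrm{Sym}\,\mathbb{R}\langle\underline{X}\rangle$ and let $\mathfrak{h}=\{h_1,\dots,h_\ell\}$ be a finite subset of $\mathrm{Sym}\,\mathbb{R}\langle\underline{X}\rangle$. Suppose that either $\mathfrak{g}=\{1,\,1-\sum_{i=1}^nX_i^2\}$ or $\mathfrak{g}=\{1\}\cup\{\frac1n-X_i^2:\ i=1,\dots,n\}$. Write $\mathfrak{g}=\{g_0,\dots,g_m\}$ with $g_0=1$. Then for every integer $k\ge k_{\min}$ the linear program $$\inf_{\xi,\mathbf{G}_i,\mathbf{H}_j}\Big\{\xi\ :\ \xi=\sum_{i=0}^m\mathrm{Tr}\big(\mathbf{G}_i\mathbf{W}_{k_{g_i}}g_i\mathbf{W}_{k_{g_i}}^*\big)+\sum_{j=1}^\ell\mathrm{Tr}\big(\mathbf{H}_j\mathbf{W}_{k_{h_j}}h_j\mathbf{W}_{k_{h_j}}^*\big)\Big\}$$ has a feasible solution, where $\xi\in\mathbb{R}$, each $\mathbf{G}_i$ ($0\le i\le m$) is a real diagonal matrix of size $\mathbf{s}(k_{g_i})$ with $\mathbf{G}_i-\mathbf{I}_i\succeq0$ ($\mathbf{I}_i$ the identity matrix), each $\mathbf{H}_j$ is a real symmetric matrix of size $\mathbf{s}(k_{h_j})$, and the displayed constraint is an identity of noncommutative polynomials. Therefore the eigenvalue minimization problem and the trace minimization problem with data $(f,\mathfrak{g},\mathfrak{h})$ satisfy the constant trace property (CTP).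
   Context: $\mathbb{R}\langle\underline{X}\rangle$ is the free algebra of polynomials in noncommuting letters $\underline{X}=(X_1,\dots,X_n)$, with the involution $*$ fixing $\mathbb{R}$ and each $X_i$ and reversing words; $\mathrm{Sym}\,\mathbb{R}\langle\underline{X}\rangle$ is the set of $p$ with $p^*=p$. $\mathbf{W}_d$ denotes both the set of all words of length at most $d$ (including the empty word $1$) and the column vector of these words in graded lexicographic order, of length $\mathbf{s}(d)=\sum_{i=0}^d n^i$; $\mathbf{W}_d^*$ is the row vector with entries $w^*$. Thus $\mathrm{Tr}(\mathbf{G}\mathbf{W}_d\,g\,\mathbf{W}_d^* )=\sum_{u,v\in\mathbf{W}_d}\mathbf{G}_{u,v}\,v\,g\,u^*$. For a polynomial $q$, $\lceil q\rceil:=\lceil\deg(q)/2\rceil$, $k_q:=k-\lceil q\rceil$. $k_{\min}:=\max\{\lceil f\rceil,\lceil g_i\rceil,\lceil h_j\rceil:1\le i\le m,1\le j\le\ell\}$. Riesz functional: for $\mathbf{y}=(y_w)_{w\in\mathbf{W}_{2k}}$ real with $y_w=y_{w^*}$, $L_{\mathbf{y}}(\sum_w q_ww)=\sum_wq_wy_w$. $\mathbf{M}_k(\mathbf{y})$ has entries $L_{\mathbf{y}}(u^*v)$, $u,v\in\mathbf{W}_k$; for symmetric $q$, $\mathbf{M}_{k_q}(q\mathbf{y})$ has entries $L_{\mathbf{y}}(u^*qv)$, $u,v\in\mathbf{W}_{k_q}$. $\mathbf{D}_k(\mathbf{y}):=\mathrm{diag}(\mathbf{M}_k(\mathbf{y}),\mathbf{M}_{k_{g_1}}(g_1\mathbf{y}),\dots,\mathbf{M}_{k_{g_m}}(g_m\mathbf{y}))$.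 $\mathcal{S}^{(k)}$ is the set of block diagonal real symmetric matrices $\mathrm{diag}(\mathbf{Y}_0,\dots,\mathbf{Y}_m)$ with $\mathbf{Y}_i$ symmetric of size $\mathbf{s}(k_{g_i})$, and $\mathcal{S}^{(k)}_{++}$ its positive definite elements. The eigenvalue minimization problem is $\inf\{\mathbf{v}^*f(\underline{A})\mathbf{v}\}$ over unit vectors $\mathbf{v}$ and tuples $\underline{A}$ of bounded self-adjoint Hilbert space operators with $g(\underline{A})\succeq0$ for all $g\in\mathfrak{g}$ and $h(\underline{A})=0$ for all $h\in\mathfrak{h}$; the trace minimization problem minimizes the normalized trace of $f(\underline{A})$ over tuples of real symmetric matrices satisfying the same constraints. CTP (the same condition on the data for both problems): for every integer $k\ge k_{\min}$ there exist $a_k>0$ and $\mathbf{P}_k\in\mathcal{S}^{(k)}_{++}$ such that for all $\mathbf{y}$ indexed by $\mathbf{W}_{2k}$ with $y_w=y_{w^*}$: if $\mathbf{M}_{k_{h_j}}(h_j\mathbf{y})=0$ for all $j=1,\dots,\ell$ and $y_1=1$, then $\mathrm{Tr}(\mathbf{P}_k^*\mathbf{D}_k(\mathbf{y})\mathbf{P}_k)=a_k$. *)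

(* Defs.v *)
From HB Require Import structures.
From mathcomp Require Import all_boot all_order all_algebra.
From mathcomp Require Import finmap reals monalg.

Set Implicit Arguments.
Unset Strict Implicit.
Unset Printing Implicit Defensive.

Import Order.TTheory GRing.Theory Num.Theory.
Local Open Scope ring_scope.

(* The free algebra R<X_1, ..., X_n>: the monoid algebra of the free monoid    *)
(* on n letters, the letter X_i being indexed by i : 'I_n.                     *)
Notation ncpoly R n := {malg R[{fmonom 'I_n}]}.

Section FreeAlgebra.
Variables (R : realType) (n : nat).
Implicit Types p q : ncpoly R n.

Definition letter (i : 'I_n) : ncpoly R n := << fmu i >>.

Definition star p : ncpoly R n :=
  \sum_(w <- msupp p) << p@_w *g FMonom (rev w) >>.

Definition nc_sym p : Prop := star p = p.

(* mmeasure is 1 + degree, and 0 at the zero polynomial; so ncdeg 0 = 0.       *)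
Definition ncdeg p : nat := (mmeasure (@fdeg 'I_n) p).-1.

Definition halfdeg p : nat := uphalf (ncdeg p).

(* k - halfdeg q is a truncated subtraction, exact as soon as k >= kmin below. *)
Definition ksub (k : nat) q : nat := (k - halfdeg q)%N.

End FreeAlgebra.

Section Words.
Variable n : nat.

Definition nwords (d : nat) : nat := (\sum_(i < d.+1) n ^ i)%N.

Fixpoint lex_words (l : nat) : seq (seq 'I_n) :=
  if l is l'.+1 then [seq x :: w | x <- enum 'I_n, w <- lex_words l']
  else [:: [::]].

Definition grlex_words (d : nat) : seq (seq 'I_n) :=
  flatten [seq lex_words l | l <- iota 0 d.+1].

Lemma size_lex_words l : size (lex_words l) = (n ^ l)%N.
Proof. by elim: l => // l IHl; rewrite size_allpairs size_enum_ord IHl expnS. Qed.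

Lemma size_grlex_words d : size (grlex_words d) == nwords d.
Proof.
rewrite size_flatten /shape -map_comp sumnE big_map /nwords.
rewrite -[iota 0 d.+1]/(index_iota 0 d.+1) big_mkord.
by apply/eqP/eq_bigr => i _ /=; rewrite size_lex_words.
Qed.

Definition word_tuple (d : nat) : (nwords d).-tuple (seq 'I_n) :=
  Tuple (size_grlex_words d).

End Words.

Section Moments.
Variables (R : realType) (n : nat).
Implicit Types p q : ncpoly R n.

(* The column W_d of all words of length at most d, and the row W_d^*.         *)
Definition Wcol (d : nat) : 'cV[ncpoly R n]_(nwords n d) :=
  \col_i << FMonom (tnth (word_tuple n d) i) >>.

Definition Wrow (d : nat) : 'rV[ncpoly R n]_(nwords n d) :=
  \row_i star (Wcol d i ord0).

Definition trW (d : nat) (G : 'M[R]_(nwords n d)) q : ncpoly R n :=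
  \tr (map_mx (fun c : R => c%:MP) G *m (Wcol d *m q%:M *m Wrow d)).

Section Sequences.
(* (2 * k).-bseq 'I_n is the type of words of length at most 2k.               *)
Variables (k : nat) (y : (2 * k).-bseq 'I_n -> R).

Definition star_invariant : Prop :=
  forall w : (2 * k).-bseq 'I_n, y [bseq of rev w] = y w.

Definition riesz q : R :=
  \sum_(w : (2 * k).-bseq 'I_n) q@_(FMonom w) * y w.

Definition localizing q : 'M[R]_(nwords n (ksub k q)) :=
  \matrix_(i, j)
    riesz (star (Wcol (ksub k q) i ord0) * q * Wcol (ksub k q) j ord0).

(* The first block of D_k(y) is M_k(y), because g_0 = 1.                       *)
Definition moment_diag (m : nat) (g : 'I_m.+1 -> ncpoly R n) :
    'M[R]_(\sum_(i < m.+1) nwords n (ksub k (g i))) :=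
  \mxdiag_(i < m.+1) localizing (g i).

End Sequences.
End Moments.

Section Matrices.
Variable R : realType.

Definition psdmx (s : nat) (M : 'M[R]_s) : Prop :=
  M^T = M /\ forall x : 'cV[R]_s, 0 <= (x^T *m M *m x) ord0 ord0.

Definition pdmx (s : nat) (M : 'M[R]_s) : Prop :=
  M^T = M /\ forall x : 'cV[R]_s, x != 0 -> 0 < (x^T *m M *m x) ord0 ord0.

Definition block_sym (m : nat) (s : 'I_m.+1 -> nat)
    (P : 'M[R]_(\sum_(i < m.+1) s i)) : Prop :=
  exists Y : forall i : 'I_m.+1, 'M[R]_(s i),
    (forall i, (Y i)^T = Y i) /\ P = \mxdiag_(i < m.+1) Y i.

End Matrices.

Section Problem.
(* The data (f, g, h) of the eigenvalue and of the trace minimization problem; *)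
(* g lists g_0 = 1, g_1, ..., g_m.                                             *)
Variables (R : realType) (n m l : nat).
Variables (f : ncpoly R n) (g : 'I_m.+1 -> ncpoly R n) (h : 'I_l -> ncpoly R n).

Definition kmin : nat :=
  maxn (halfdeg f) (maxn (\max_(i < m.+1 | (0 < i)%N) halfdeg (g i))
                         (\max_(j < l) halfdeg (h j))).

Definition lp_feasible (k : nat) (xi : R)
    (G : forall i : 'I_m.+1, 'M[R]_(nwords n (ksub k (g i))))
    (H : forall j : 'I_l, 'M[R]_(nwords n (ksub k (h j)))) : Prop :=
  [/\ forall i, is_diag_mx (G i) /\ psdmx (G i - 1%:M),
      forall j, (H j)^T = H j
    & xi%:MP = \sum_(i < m.+1) trW (G i) (g i) + \sum_(j < l) trW (H j) (h j)].

(* The constant trace property is one and the same condition on (f, g, h) for  *)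
(* the eigenvalue and for the trace minimization problem.                      *)
Definition CTP : Prop :=
  forall k : nat, (kmin <= k)%N ->
  exists (a : R) (P : 'M[R]_(\sum_(i < m.+1) nwords n (ksub k (g i)))),
    [/\ 0 < a, block_sym P, pdmx P
      & forall y : (2 * k).-bseq 'I_n -> R,
          star_invariant y ->
          (forall j, localizing y (h j) = 0) ->
          y [bseq] = 1 ->
          \tr (P^T *m moment_diag y g *m P) = a].

End Problem.

(* Main.v *)
Require Import Defs.
From HB Require Import structures.
From mathcomp Require Import all_boot all_order all_algebra.
From mathcomp Require Import finmap reals monalg.

Import Order.TTheory GRing.Theory Num.Theory.
Local Open Scope ring_scope.

(** Let [S] be the sum of the squares of the letters, and let [T_l] be the sum
    of [w^* w] over the words [w] of length [l].  In both cases the nontrivial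
    constraints add up to the ball constraint [1 - S], since the [n] constraints
    [1/n - X_i^2] do so; hence it suffices to give all nontrivial constraints
    the same weights.  Since [x w] runs over the words of length [l + 1] when
    [x] runs over the letters and [w] over the words of length [l], the sum of
    [w^* (1 - S) w] over the words of length [l] is [T_l - T_(l+1)].  With
    weight [1] on every word for [g_0 = 1], and weight [k - l >= 1] on the words
    of length [l < k] for the other constraints, everything but the constant
    cancels ([weighted_telescope]):
    [T_0 + ... + T_k + sum_(l < k) (k - l) (T_l - T_(l+1)) = (k + 1) T_0],
    and [T_0 = 1].  This is [certificate].

    The linear program has the terms [w g w^*] instead of [w^* g w].  The
    weights depend only on the length of [w], and reversal permutes the words of
    each length, so the same weights, with [H_j = 0], form a feasible solution
    with value [k + 1] ([lp_feasible_diag_weight]).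

    For the constant trace property, take for [P] the diagonal matrix of the
    square roots of the weights.  The diagonal entries of the localizing
    matrices are the values of the Riesz functional at [w^* g_i w], so the trace
    is the value of this functional at the left-hand side of the certificate,
    that is [(k + 1) y_1 = k + 1] ([tr_moment_diag]). *)

(** * Summation by parts *)

Lemma weighted_telescope (V : zmodType) (a : nat -> V) (k : nat) :
  \sum_(l < k.+1) a l + \sum_(l < k) (a l - a l.+1) *+ (k - l) = a 0%N *+ k.+1.
Proof.
elim: k => [|k IHk]; first by rewrite big_ord0 addr0 big_ord1.
(* Raising k by 1 raises every weight by 1, which adds an ordinary telescope. *)
have splitW : \sum_(l < k.+1) (a l - a l.+1) *+ (k.+1 - l) =
    \sum_(l < k.+1) (a l - a l.+1) *+ (k - l) + \sum_(l < k.+1) (a l - a l.+1).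
  by rewrite -big_split; apply: eq_bigr => l _; rewrite subSn -1?ltnS // mulrSr.
have tele : \sum_(l < k.+1) (a l - a l.+1) = a 0%N - a k.+1.
  rewrite -(big_mkord xpredT (fun l => a l - a l.+1)).
  rewrite -[RHS]opprB -telescope_sumr // -sumrN.
  by apply: eq_bigr => l _; rewrite opprB.
have lastW : \sum_(l < k.+1) (a l - a l.+1) *+ (k - l)
    = \sum_(l < k) (a l - a l.+1) *+ (k - l).
  by rewrite big_ord_recr /= subnn mulr0n addr0.
rewrite splitW tele lastW big_ord_recr /= addrACA IHk [a k.+1 + _]addrC subrK.
by rewrite -mulrSr.
Qed.

(** * Diagonal matrices *)

Section DiagonalMatrices.
Variable R : realType.

Lemma psdmx_diag d (D : 'rV[R]_d) :
  (forall j, 0 <= D ord0 j) -> psdmx (diag_mx D).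
Proof.
move=> D_ge0; split=> [|x]; first exact: tr_diag_mx.
rewrite -mulmxA mul_diag_mx !mxE sumr_ge0 // => j _; rewrite !mxE.
by rewrite mulrCA mulr_ge0 // -expr2 sqr_ge0.
Qed.

Lemma pdmx_diag d (D : 'rV[R]_d) :
  (forall j, 0 < D ord0 j) -> pdmx (diag_mx D).
Proof.
move=> D_gt0; split=> [|x x0]; first exact: tr_diag_mx.
have /existsP[j xj] : [exists j, x j ord0 != 0].
  apply: contraNT x0 => /existsPn x0; apply/eqP/colP => j.
  by rewrite mxE; apply/eqP/negPn/x0.
have term i : x^T ord0 i * (diag_mx D *m x) i ord0 = D ord0 i * x i ord0 ^+ 2.
  by rewrite mul_diag_mx !mxE mulrCA expr2.
rewrite -mulmxA mxE (bigD1 j) //= ltr_wpDr //.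
  by apply: sumr_ge0 => i _; rewrite term mulr_ge0 ?sqr_ge0 // ltW.
by rewrite term mulr_gt0 // exprn_even_gt0.
Qed.

Lemma mxtrace_diag_conj d (D : 'rV[R]_d) (M : 'M[R]_d) :
  \tr ((diag_mx D)^T *m M *m diag_mx D) = \sum_j D ord0 j ^+ 2 * M j j.
Proof.
rewrite tr_diag_mx /mxtrace; apply: eq_bigr => j _.
by rewrite mul_mx_diag mul_diag_mx !mxE mulrAC expr2.
Qed.

End DiagonalMatrices.

(** * Finite sums over ranges and over words *)

Lemma big_codom (I : finType) (V : nmodType) (F : I -> V) (L : seq V) :
  injective F -> uniq L -> codom F =i L -> \sum_i F i = \sum_(x <- L) x.
Proof.
move=> F_inj L_uniq FL; rewrite -(perm_big _ (uniq_perm _ L_uniq FL)) /=.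
  by rewrite big_image.
by rewrite map_inj_uniq ?enum_uniq.
Qed.

Section Words.
Variable n : nat.

Lemma mem_lex_words l (w : seq 'I_n) : (w \in lex_words n l) = (size w == l).
Proof.
elim: l w => [|l IHl] w /=; first by rewrite inE size_eq0.
apply/allpairsP/idP => [[[x v] /= [_ + ->]]|]; first by rewrite IHl.
case: w => // x w; rewrite eqSS => sw; exists (x, w).
by rewrite /= mem_enum IHl.
Qed.

Lemma lex_words_uniq l : uniq (lex_words n l).
Proof.
elim: l => //= l IHl; apply: allpairs_uniq => //; first exact: enum_uniq.
by move=> [x v] [y w] _ _ [-> ->].
Qed.

Lemma perm_rev_lex_words l :
  perm_eq [seq rev w | w <- lex_words n l] (lex_words n l).
Proof.
apply: uniq_perm; rewrite ?(map_inj_uniq (can_inj revK)) ?lex_words_uniq //.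
by move=> w; rewrite -[w]revK (mem_map (can_inj revK)) !mem_lex_words !size_rev.
Qed.

Lemma big_rev_lex_words (V : nmodType) (F : seq 'I_n -> V) l :
  \sum_(w <- lex_words n l) F (rev w) = \sum_(w <- lex_words n l) F w.
Proof. by rewrite -[RHS](perm_big _ (perm_rev_lex_words l)) big_map. Qed.

Lemma big_grlex_words (V : nmodType) (F : seq 'I_n -> V) d :
  \sum_(w <- grlex_words n d) F w
    = \sum_(l < d.+1) \sum_(w <- lex_words n l) F w.
Proof.
rewrite big_flatten big_map -[iota 0 d.+1]/(index_iota 0 d.+1).
by rewrite big_mkord.
Qed.

Lemma big_word_tuple (V : nmodType) (F : seq 'I_n -> V) d :
  \sum_(i < nwords n d) F (tnth (word_tuple n d) i)
    = \sum_(w <- grlex_words n d) F w.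
Proof. by rewrite -[RHS]/(\sum_(w <- word_tuple n d) F w) big_tuple. Qed.

Lemma big_rev_grlex_words (V : nmodType) (F : seq 'I_n -> V) d :
  \sum_(w <- grlex_words n d) F (rev w) = \sum_(w <- grlex_words n d) F w.
Proof.
by rewrite !big_grlex_words; apply: eq_bigr => l _; apply: big_rev_lex_words.
Qed.

Lemma size_grlex_word w d : w \in grlex_words n d -> (size w <= d)%N.
Proof.
case/flatten_mapP => l; rewrite mem_iota add0n ltnS /=.
by rewrite mem_lex_words => ld /eqP ->.
Qed.

End Words.

(** * Words as monomials of the free algebra *)

Section FreeAlgebra.
Variables (R : realType) (n : nat).
Implicit Types (p q : ncpoly R n) (u v w : seq 'I_n).

Definition monom w : ncpoly R n := << FMonom w >>.

Lemma monomM u v : monom u * monom v = monom (u ++ v).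
Proof.
by rewrite malgM_def fgmulUU mulr1 /monom -(fmmulE (FMonom u) (FMonom v)).
Qed.

Lemma monom_nil : monom [::] = 1.
Proof. by rewrite /monom -fmoneE. Qed.

Lemma letterE i : letter R i = monom [:: i].
Proof. by rewrite /letter fmuE. Qed.

Lemma letter_sqr i : letter R i ^+ 2 = monom [:: i; i].
Proof. by rewrite letterE expr2 monomM. Qed.

Lemma mcoeff_monom v w : (monom v)@_(FMonom w) = (v == w)%:R.
Proof. by rewrite mcoeffU1. Qed.

Lemma star_monom w : star (monom w) = monom (rev w).
Proof. by rewrite /star msuppU1 big_seq_fset1 mcoeffUU. Qed.

(** The localizing matrices have [w^* q w] on their diagonal, with the starred
    word on the left; with this orientation, prepending a letter to [w] is what
    absorbs a square in the middle, in accordance with the recursion that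
    enumerates the words of length [l + 1]. *)
Definition sandwich q w : ncpoly R n := monom (rev w) * q * monom w.

Lemma sandwichB p q w : sandwich (p - q) w = sandwich p w - sandwich q w.
Proof. by rewrite /sandwich mulrBr mulrBl. Qed.

Lemma sandwich_sum (I : Type) (r : seq I) (P : pred I) (F : I -> ncpoly R n) w :
  sandwich (\sum_(i <- r | P i) F i) w = \sum_(i <- r | P i) sandwich (F i) w.
Proof. by rewrite /sandwich mulr_sumr mulr_suml. Qed.

Lemma sandwich_sqr i w : sandwich (letter R i ^+ 2) w = sandwich 1 (i :: w).
Proof.
by rewrite /sandwich letter_sqr mulr1 !monomM rev_cons -cats1 -!catA.
Qed.

Definition level l : ncpoly R n := \sum_(w <- lex_words n l) sandwich 1 w.

Lemma level0 : level 0 = 1.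
Proof. by rewrite /level big_seq1 /sandwich monom_nil !mul1r. Qed.

(** The squares in the ball constraint turn the words of length [l] into those
    of length [l + 1], which makes the weighted sum telescope. *)
Lemma level_ball l :
  \sum_(w <- lex_words n l) sandwich (1 - \sum_(i < n) letter R i ^+ 2) w
    = level l - level l.+1.
Proof.
under eq_bigr => w _ do rewrite sandwichB.
rewrite sumrB /level /= big_allpairs_dep /= big_enum exchange_big /=.
congr (_ - _); apply: eq_bigr => w _.
by rewrite sandwich_sum; apply: eq_bigr => i _; apply: sandwich_sqr.
Qed.

(** * The Riesz functional *)

Section Riesz.
Variables (k : nat) (y : (2 * k).-bseq 'I_n -> R).

Lemma riesz_is_zmod_morphism : zmod_morphism (riesz y).
Proof.
move=> p q; rewrite /riesz -sumrB; apply: eq_bigr => w _.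
by rewrite mcoeffB mulrBl.
Qed.

HB.instance Definition _ :=
  GRing.isZmodMorphism.Build _ _ (riesz y) riesz_is_zmod_morphism.

Lemma rieszC c : riesz y c%:MP = c * y [bseq].
Proof.
rewrite /riesz (bigD1 [bseq]) //= big1 => [|w w0]; last first.
  rewrite mcoeffC; case: eqP => [E|]; last by rewrite mul0r.
  case/negP: w0; apply/eqP/val_inj.
  by move/(congr1 (@fmonom_val _)): E; rewrite fm1.
by rewrite addr0 mcoeffC -[_ == _]/(FMonom [::] == fmone _) fmoneE eqxx.
Qed.

End Riesz.

(** * The certificate and its two uses *)

(** The drop by [1] from each length to the next compensates the unit weights of
    [g_0]; the weight is still [1] at the last admissible length [k - 1]. *)
Definition weight {m : nat} (k : nat) (i : 'I_m.+1) w : nat :=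
  if i == ord0 then 1%N else (k - size w)%N.

Lemma halfdeg1 : halfdeg (1 : ncpoly R n) = 0%N.
Proof. by rewrite /halfdeg /ncdeg mmeasureC oner_neq0. Qed.

Section Certificate.
Variables (m k : nat) (g : 'I_m.+1 -> ncpoly R n).
Hypothesis g0 : g ord0 = 1.
Hypothesis g_half : forall i, i != ord0 -> halfdeg (g i) = 1%N.
Hypothesis g_sum : \sum_i g i = 1 + (1 - \sum_(i < n) letter R i ^+ 2).
Hypothesis k_gt0 : (0 < k)%N.

Lemma ksub_g i : ksub k (g i) = if i == ord0 then k else k.-1.
Proof.
rewrite /ksub; case: eqVneq => [->|/g_half ->]; last by rewrite subn1.
by rewrite g0 halfdeg1 subn0.
Qed.

Lemma weight_gt0 i w :
  w \in grlex_words n (ksub k (g i)) -> (0 < weight k i w)%N.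
Proof.
rewrite ksub_g /weight => /size_grlex_word; case: eqP => // _.
by rewrite subn_gt0 -ltnS prednK.
Qed.

(** Only the sum of the nontrivial constraints matters, because they all carry
    the same weights and have the same degree. *)
Lemma certificate :
  \sum_i \sum_(w <- grlex_words n (ksub k (g i)))
      sandwich (g i) w *+ weight k i w
    = k.+1%:R%:MP.
Proof.
have gS : \sum_(i | i != ord0) g i = 1 - \sum_(i < n) letter R i ^+ 2.
  by apply: (addrI 1); rewrite -g_sum [RHS](bigD1 ord0) //= g0.
rewrite (bigD1 ord0) // {1}ksub_g (eqxx ord0) g0.
have -> : \sum_(i | i != ord0) \sum_(w <- grlex_words n (ksub k (g i)))
      sandwich (g i) w *+ weight k i w
    = \sum_(w <- grlex_words n k.-1)
        sandwich (1 - \sum_(i < n) letter R i ^+ 2) w *+ (k - size w).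
  rewrite -gS; under [RHS]eq_bigr => w _ do rewrite sandwich_sum -sumrMnl.
  rewrite [RHS]exchange_big; apply: eq_bigr => i /negPf i0 /=.
  by rewrite ksub_g /weight i0.
have -> : k.+1%:R%:MP = level 0 *+ k.+1 by rewrite level0 mpolyC_nat.
rewrite -weighted_telescope !big_grlex_words prednK //.
congr +%R; apply: eq_bigr => l _.
rewrite -level_ball -sumrMnl big_seq [RHS]big_seq; apply: eq_bigr => w.
by rewrite mem_lex_words => /eqP ->.
Qed.

(** The function [F] is the injection of the naturals for the program, and its
    square root for the matrix [P]. *)
Definition diag_weight (F : nat -> R) i : 'M[R]_(nwords n (ksub k (g i))) :=
  diag_mx (\row_j F (weight k i (tnth (word_tuple n _) j))).

Lemma trW_diag d (D : 'rV[R]_(nwords n d)) q :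
  trW (diag_mx D) q =
  \sum_j D ord0 j *: sandwich q (rev (tnth (word_tuple n d) j)).
Proof.
rewrite /trW /mxtrace; apply: eq_bigr => j _.
rewrite mxE (bigD1 j) //= big1 => [|i /negPf ij]; last first.
  by rewrite !mxE [_ == _]eq_sym ij mulr0n mul_malgC scale0r.
rewrite addr0 !mxE eqxx mulr1n mul_malgC; congr (_ *: _).
rewrite big_ord1 !mxE big_ord1 !mxE eqxx mulr1n.
by rewrite star_monom /sandwich revK.
Qed.

(** Weights that depend only on the length do not see the reversal that
    exchanges [w g w^*] and [w^* g w]. *)
Lemma lp_feasible_diag_weight l (h : 'I_l -> ncpoly R n) :
  lp_feasible k.+1%:R (diag_weight (fun c => c%:R))
    (fun j => 0 : 'M[R]_(nwords n (ksub k (h j)))).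
Proof.
split=> [i|j|]; first split; first exact: diag_mx_is_diag.
- have -> : diag_weight (fun c => c%:R) i - 1%:M
    = diag_mx (\row_j ((weight k i (tnth (word_tuple n _) j))%:R - 1)).
    rewrite /diag_weight -diag_const_mx -raddfB /=.
    by congr diag_mx; apply/rowP => j; rewrite !mxE.
  apply: psdmx_diag => j; rewrite mxE subr_ge0 ler1n weight_gt0 //.
  exact: mem_tnth.
- exact: trmx0.
rewrite [X in _ + X]big1 ?addr0 => [|j _]; last first.
  by rewrite /trW map_mx0 mul0mx mxtrace0.
rewrite -certificate; apply: eq_bigr => i _.
rewrite trW_diag -[LHS]big_rev_grlex_words -[LHS]big_word_tuple.
apply: eq_bigr => j _; rewrite mxE scaler_nat.
by rewrite /weight size_rev.
Qed.

Lemma localizing_diag (y : (2 * k).-bseq 'I_n -> R) q j :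
  localizing y q j j = riesz y (sandwich q (tnth (word_tuple n _) j)).
Proof. by rewrite !mxE star_monom. Qed.

Definition sqrt_weight i := diag_weight (fun c => Num.sqrt c%:R) i.

(** The trace is the Riesz functional at the certificate: the two factors [P]
    contribute the squares of the square roots of the weights. *)
Lemma tr_moment_diag (y : (2 * k).-bseq 'I_n -> R) :
  y [bseq] = 1 ->
  \tr ((\mxdiag_i sqrt_weight i)^T *m moment_diag y g
         *m (\mxdiag_i sqrt_weight i))
    = k.+1%:R.
Proof.
move=> y1; rewrite tr_mxdiag mul_mxdiag_mxblock mul_mxblock_mxdiag.
have -> : k.+1%:R = riesz y k.+1%:R%:MP by rewrite rieszC y1 mulr1.
rewrite mxtrace_mxblock -certificate raddf_sum /=.
apply: eq_bigr => i _; rewrite eqxx conform_mx_id mxtrace_diag_conj.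
rewrite raddf_sum -big_word_tuple; apply: eq_bigr => j _.
by rewrite mxE sqr_sqrtr ?ler0n // localizing_diag /= raddfMn mulr_natl.
Qed.

Lemma pdmx_sqrt_weight : pdmx (\mxdiag_i sqrt_weight i).
Proof.
rewrite /sqrt_weight /diag_weight -diag_mxrow; apply: pdmx_diag => j.
by rewrite !mxE sqrtr_gt0 ltr0n weight_gt0 // mem_tnth.
Qed.

Lemma block_sym_sqrt_weight : block_sym (\mxdiag_i sqrt_weight i).
Proof. by exists sqrt_weight; split=> // i; apply: tr_diag_mx. Qed.

End Certificate.

(** * The ball and the box constraints *)

(** Both families consist of such polynomials: the ball is the case where [s]
    lists all letters, and the box constraints are those where [s] is a single
    letter. *)
Definition quadratic (c : R) (s : seq 'I_n) : ncpoly R n :=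
  c%:MP - \sum_(i <- s) letter R i ^+ 2.

Lemma mcoeff_quadratic c s i :
  uniq s -> (quadratic c s)@_(FMonom [:: i; i]) = - (i \in s)%:R.
Proof.
move=> s_uniq; rewrite mcoeffB mcoeffC.
rewrite -[_ == _]/(FMonom [:: i; i] == fmone _) fmoneE mulr0n sub0r.
rewrite raddf_sum /= -(count_uniq_mem i s_uniq) -sum1_count natr_sum.
rewrite [in RHS]big_mkcond /=; congr (- _); apply: eq_bigr => j _.
by rewrite letter_sqr mcoeff_monom !eqseq_cons andbT andbb /=; case: (j == i).
Qed.

Lemma halfdeg_quadratic c s :
  uniq s -> s != [::] -> halfdeg (quadratic c s) = 1%N.
Proof.
case: s => // i s s_uniq _; rewrite /halfdeg /ncdeg.
have sqr_le j : (mmeasure (@fdeg 'I_n) (letter R j ^+ 2) <= 3)%N.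
  by rewrite letter_sqr mmeasureE msuppU1 big_seq_fset1.
suff -> : mmeasure (@fdeg 'I_n) (quadratic c (i :: s)) = 3%N by [].
apply/eqP; rewrite eqn_leq; apply/andP; split.
  apply: leq_trans (mmeasureD_le _ _ _) _; rewrite geq_max mmeasureN mmeasureC.
  apply/andP; split; first by case: (c != 0).
  by apply: leq_trans (mmeasure_sum _ _ _ _) _; apply/bigmax_leqP_seq.
apply: (@mmeasure_mnm_lt _ _ _ _ (FMonom [:: i; i])).
by rewrite -mcoeff_neq0 mcoeff_quadratic // mem_head oppr_eq0 oner_neq0.
Qed.

Lemma quadratic_neq1 c s : uniq s -> s != [::] -> quadratic c s != 1.
Proof.
move=> s_uniq s0; apply/eqP => /(congr1 (@halfdeg R n)).
by rewrite halfdeg_quadratic // halfdeg1.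
Qed.

(** The enumeration [g] has no repetition, so its nontrivial members can be read
    off from the codomain once the listed polynomials are known to be distinct;
    this is why they are told apart, by a coefficient or by their degree. *)
Lemma ball_constraints m (g : 'I_m.+1 -> ncpoly R n) :
  (0 < n)%N -> injective g -> g ord0 = 1 ->
  (codom g =i [:: 1; 1 - \sum_(i < n) letter R i ^+ 2]
   \/ codom g =i
        1 :: [seq ((n%:R^-1 : R)%:MP - letter R i ^+ 2 : ncpoly R n)
             | i <- enum 'I_n]) ->
  (forall i, i != ord0 -> halfdeg (g i) = 1%N)
  /\ \sum_i g i = 1 + (1 - \sum_(i < n) letter R i ^+ 2).
Proof.
move=> n_gt0 g_inj g0 codom_g.
have enum_neq0 : enum 'I_n != [::] by rewrite -size_eq0 size_enum_ord -lt0n.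
have ballE : 1 - \sum_(i < n) letter R i ^+ 2 = quadratic 1 (enum 'I_n).
  by rewrite /quadratic big_enum.
have boxE i : (n%:R^-1 : R)%:MP - letter R i ^+ 2 = quadratic n%:R^-1 [:: i].
  by rewrite /quadratic big_seq1.
suff [L [L1 L_uniq L_half L_sum]] : exists L, [/\ codom g =i 1 :: L,
    uniq (1 :: L), forall q, q \in L -> halfdeg q = 1%N
    & \sum_(q <- L) q = 1 - \sum_(i < n) letter R i ^+ 2].
  split=> [i i0|]; last first.
    by rewrite (big_codom _ _ _ _ g_inj L_uniq L1) big_cons L_sum.
  apply: L_half; have := codom_f g i; rewrite L1 inE -{1}g0 (inj_eq g_inj).
  by rewrite (negPf i0).
case: codom_g => cod.
  exists [:: 1 - \sum_(i < n) letter R i ^+ 2]; split=> //.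
  - by rewrite /= inE ballE eq_sym quadratic_neq1 ?enum_uniq.
  - move=> q; rewrite inE ballE => /eqP ->.
    by rewrite halfdeg_quadratic ?enum_uniq.
  - by rewrite [LHS]big_seq1.
exists [seq quadratic n%:R^-1 [:: i] | i <- enum 'I_n]; split.
- by move=> q; rewrite cod (eq_map boxE).
- rewrite /= map_inj_uniq ?enum_uniq ?andbT.
    by apply/mapP => -[i _ /esym/eqP]; apply/negP/quadratic_neq1.
  move=> i j /(congr1 (mcoeff (FMonom [:: i; i]))).
  rewrite !mcoeff_quadratic // !inE eqxx; case: eqP => // _ /eqP.
  by rewrite oppr0 oppr_eq0 oner_eq0.
- by move=> q /mapP[i _ ->]; rewrite halfdeg_quadratic.
rewrite big_map; under eq_bigr => i _ do rewrite -boxE.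
rewrite big_enum sumrB sumr_const card_ord; congr (_ - _).
apply/malgP => w; rewrite mcoeffMn [in LHS]mcoeffC mcoeff1.
by rewrite mulrnAC -[_ *+ n]mulr_natr mulVf // pnatr_eq0 -lt0n.
Qed.

(** At least one constraint is nontrivial, for otherwise [1 - S] would vanish;
    its degree [2] then forces a positive relaxation order. *)
Lemma kmin_gt0 m l f (g : 'I_m.+1 -> ncpoly R n) (h : 'I_l -> ncpoly R n) :
  (0 < n)%N -> g ord0 = 1 ->
  (forall i, i != ord0 -> halfdeg (g i) = 1%N) ->
  \sum_i g i = 1 + (1 - \sum_(i < n) letter R i ^+ 2) ->
  (0 < kmin f g h)%N.
Proof.
move=> n_gt0 g0 g_half g_sum.
have [i i0 | g_only0] := pickP (fun i : 'I_m.+1 => i != ord0); last first.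
  have : quadratic 1 (enum 'I_n) != 0.
    apply/eqP => /(congr1 (@halfdeg R n)).
    rewrite halfdeg_quadratic ?enum_uniq -?size_eq0 ?size_enum_ord -?lt0n //.
    by rewrite /halfdeg /ncdeg mmeasure0.
  case/eqP; apply: (addrI 1); rewrite /quadratic big_enum -g_sum addr0.
  by rewrite (bigD1 ord0) //= big_pred0 ?addr0.
rewrite /kmin !leq_max; apply/orP; right; apply/orP; left.
have i_gt0 : (0 < i)%N by rewrite lt0n.
have := @leq_bigmax_cond _ (fun i : 'I_m.+1 => 0 < i)%N
  (fun i => halfdeg (g i)) i i_gt0.
by rewrite g_half.
Qed.

End FreeAlgebra.

Theorem proposition3p10 (R : realType) (n m l : nat) (f : ncpoly R n)
    (g : 'I_m.+1 -> ncpoly R n) (h : 'I_l -> ncpoly R n) :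
  (0 < n)%N ->
  nc_sym f ->
  (forall j, nc_sym (h j)) ->
  injective g ->
  g ord0 = 1 ->
  (codom g =i [:: 1; 1 - \sum_(i < n) letter R i ^+ 2]
   \/ codom g =i
        1 :: [seq ((n%:R^-1 : R)%:MP - letter R i ^+ 2 : ncpoly R n)
             | i <- enum 'I_n]) ->
  (forall k : nat, (kmin f g h <= k)%N ->
     exists (xi : R)
            (G : forall i : 'I_m.+1, 'M[R]_(nwords n (ksub k (g i))))
            (H : forall j : 'I_l, 'M[R]_(nwords n (ksub k (h j)))),
       lp_feasible xi G H)
  /\ CTP f g h.
Proof.
move=> n_gt0 _ _ g_inj g0.
case/(ball_constraints _ _ _ _ n_gt0 g_inj g0) => g_half g_sum.
have k_gt0 k : (kmin f g h <= k)%N -> (0 < k)%N.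
  by apply: leq_trans; apply: kmin_gt0.
split=> k /k_gt0 {}k_gt0; first by do 3!eexists; apply: lp_feasible_diag_weight.
exists k.+1%:R, (\mxdiag_i sqrt_weight R n m k g i); split.
- exact: ltr0Sn.
- exact: block_sym_sqrt_weight.
- exact: pdmx_sqrt_weight.
by move=> y _ _; apply: tr_moment_diag.
Qed.
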